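(* Let $\eta(x,y)=x-y$ for $x,y\in\mathbb{R}^n$, and let $\mathcal{P}=\{x_1,\dots,x_k\}$ be a set of $k$ points in $\mathbb{R}^n$. Then the matrix $\mathcal{Y}(\mathcal{P})\in\mathbb{R}^{n^2k\times k}$ associated with $\eta$ and $\mathcal{P}$ satisfies $$\mathrm{rank}(\mathcal{Y}(\mathcal{P}))=\min\Big\{k,\frac{(n+1)(n+2)}{2}\Big\},$$ and therefore, for $k>\frac{(n+1)(n+2)}{2}$, the system $$\sum_{i=1}^k f_iY_{ji}=C_j,\qquad j=1,\dots,k,$$ in the unknown $f=(f_1,\dots,f_k)\in\mathbb{R}^k$, where $C_j=\sum_{i=1}^k f^0_i Y_{ji}$ for some $f^0\in\mathbb{R}^k$, does not have a unique solution.
   Context: For $i,j=1,\dots,k$ put $Y_{ji}=\eta(x_j,x_i)\eta(x_j,x_i)^T$, a symmetric $n\times n$ matrix with entries $Y_{ji}^{lm}$, $l,m=1,\dots,n$. For each $l,m\in\{1,\dots,n\}$ let $B_{lm}\in\mathbb{R}^{k\times k}$ be the matrix whose entry in row $j$ and column $i$ is $Y_{ji}^{lm}$. The matrix $\mathcal{Y}=\mathcal{Y}(\mathcal{P})\in\mathbb{R}^{n^2k\times k}$ is obtained by stacking these $n^2$ matrices vertically: $\mathcal{Y}=[B_{11}^T\ \dots\ B_{1n}^T\ \dots\ B_{n1}^T\ \dots\ B_{nn}^T]^T$. Thus, with $\mathcal{C}=[C_1^{11}\dots C_k^{11}\,C_1^{12}\dots C_k^{12}\dots C_1^{nn}\dots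 C_k^{nn}]^T$, the system $\sum_i f_iY_{ji}=C_j$ ($j=1,\dots,k$) is equivalent to $\mathcal{Y}f=\mathcal{C}$.
   Formalization: The rank formula is false for arbitrary point sets (one point; four collinear points in the plane). It is proved for k > 1 points in general position with respect to polynomials of degree at most 2, a condition shown to be generic; non-uniqueness is proved for every set of k points. *)

(* Defs.v *)
From HB Require Import structures.
From mathcomp Require Import all_boot all_order all_algebra.
From mathcomp Require Import reals.
From mathcomp Require Import mpoly.

Set Implicit Arguments.
Unset Strict Implicit.
Unset Printing Implicit Defensive.

Import GRing.Theory.
Local Open Scope ring_scope.

(* A point set with k elements in R^n is an injective family
   x : 'I_k -> 'cV[R]_n. *)

Definition outer_sq (R : realType) (n k : nat)
    (eta : 'cV[R]_n -> 'cV[R]_n -> 'cV[R]_n) (x : 'I_k -> 'cV[R]_n)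
    (j i : 'I_k) : 'M[R]_n :=
  eta (x j) (x i) *m (eta (x j) (x i))^T.

Definition Bblock (R : realType) (n k : nat)
    (eta : 'cV[R]_n -> 'cV[R]_n -> 'cV[R]_n) (x : 'I_k -> 'cV[R]_n)
    (l m : 'I_n) : 'M[R]_k :=
  \matrix_(j, i) outer_sq eta x j i l m.

Lemma stack_height (n k : nat) :
  (\sum_(l < n) \sum_(m < n) k = n ^ 2 * k)%N.
Proof. by rewrite !sum_nat_const !card_ord mulnA. Qed.

(* The blocks are stacked in lexicographic order of (l, m); the cast only
   normalizes the height of the stack to n ^ 2 * k. *)
Definition Ymatrix (R : realType) (n k : nat)
    (eta : 'cV[R]_n -> 'cV[R]_n -> 'cV[R]_n) (x : 'I_k -> 'cV[R]_n) :
    'M[R]_(n ^ 2 * k, k) :=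
  castmx (stack_height n k, erefl k)
    (\mxcol_(l < n) \mxcol_(m < n) Bblock eta x l m).

Definition eta_sub (R : realType) (n : nat) (x y : 'cV[R]_n) : 'cV[R]_n :=
  x - y.

(* The dimension of the space of polynomials of degree at most 2 in n
   variables. *)
Definition quad_dim (n : nat) : nat := ((n + 1) * (n + 2)) %/ 2.

Definition evalpt (R : realType) (n : nat) (q : {mpoly R[n]}) (y : 'cV[R]_n) : R :=
  q.@[fun l => y l 0].

(* General position with respect to quadrics; msize q <= 3 says that q has
   total degree at most 2.  The points impose as many independent conditions
   as possible on such q: arbitrary values can be interpolated if there are at
   most quad_dim n points, and the points lie on no quadric if there are at
   least quad_dim n points. *)
Definition quadric_general_position (R : realType) (n k : nat)
    (x : 'I_k -> 'cV[R]_n) : Prop :=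
  ((k <= quad_dim n)%N ->
     forall v : 'I_k -> R, exists2 q : {mpoly R[n]},
       (msize q <= 3)%N & forall i, evalpt q (x i) = v i) /\
  ((quad_dim n <= k)%N ->
     forall q : {mpoly R[n]}, (msize q <= 3)%N ->
       (forall i, evalpt q (x i) = 0) -> q = 0).

(* A holds outside the zero set of a nonzero polynomial in the k * n
   coordinates of the points. *)
Definition generically (R : realType) (n k : nat)
    (A : ('I_k -> 'cV[R]_n) -> Prop) : Prop :=
  exists2 p : {mpoly R[k * n]}, p != 0 &
    forall x : 'I_k -> 'cV[R]_n,
      p.@[mxvec (\matrix_(i < k, l < n) x i l 0) 0] != 0 -> A x.

(* Main.v *)
Require Import Defs.
From mathcomp Require Import all_boot all_order all_algebra perm.
From mathcomp Require Import reals.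
From mathcomp Require Import mpoly.
From mathcomp Require Import ring.

Set Implicit Arguments.
Unset Strict Implicit.
Unset Printing Implicit Defensive.

Import GRing.Theory Num.Theory.
Local Open Scope ring_scope.

(** Let W be the k x N matrix of the values of the N monomials of degree at
    most 2 at the k points.  The whole theorem rests on one fact: for at least
    two distinct points, the matrix Y and the transpose of W have the same
    kernel ([outer_sq_kernel]), hence the same rank ([Ymatrix_rank]).

    To see this, give each point x_i the weight f_i and let S0, S1, S2 be the
    moments of orders 0, 1, 2.  Then W^T f = 0 says that S0, S1, S2 all vanish
    ([veronese_kernel]), while Y f = 0 says that, for every j,
        S0 x_j x_j^T - x_j S1^T - S1 x_j^T + S2 = 0        ([sum_outer_sqE]),
    so the first condition implies the second.  Conversely:
    - if S0 <> 0, completing the square shows that the vectors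
      S0 x_j - S1 all have the same outer square, so they agree up to sign
      ([outer_sq_eq]); there are then only two points, and the equations
      give f = 0, against S0 <> 0;
    - if S0 = 0 and S1 <> 0, subtracting two equations shows that
      d = x_j - x_j' satisfies d S1^T + S1 d^T = 0, which forces d = 0
      ([sym_outer_eq0]), against the injectivity of x;
    - if S0 = 0 and S1 = 0, the equation reads S2 = 0.

    The number N of columns of W is (n + 1)(n + 2) / 2
    ([card_quad_monomials]), and general position means exactly that W has the
    largest possible rank min (k, N) ([general_position_rank]).  This gives the
    rank of Y; and if k > N, a nonzero vector of the kernel of W^T can be added
    to any solution of the linear system.

    Finally, general position is generic because it follows from the
    nonvanishing of one maximal minor of W, and this minor, as a polynomial in
    the coordinates of all the points, is not zero: the terms of its Leibniz
    expansion are distinct monomials with coefficients 1 or -1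
    ([det_placed_monoms_neq0]). *)

(** * Ranks and kernels *)

Lemma mxrank_castmx_row (F : fieldType) (m m' p : nat) (e : m = m')
    (A : 'M[F]_(m, p)) :
  \rank (castmx (e, erefl p) A) = \rank A.
Proof. by case: _ / e; rewrite castmx_id. Qed.

(** Rank-nullity for the action on columns; [kermx] is the kernel of the action
    on rows, hence the transpositions. *)
Lemma eq_colker_rank (F : fieldType) (m p k : nat)
    (A : 'M[F]_(m, k)) (B : 'M[F]_(p, k)) :
  (forall f : 'cV[F]_k, A *m f = 0 <-> B *m f = 0) -> \rank A = \rank B.
Proof.
move=> eqAB.
have ker_le (m1 m2 : nat) (C : 'M[F]_(m1, k)) (D : 'M[F]_(m2, k)) :
    (forall f : 'cV[F]_k, C *m f = 0 -> D *m f = 0) ->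
    (kermx C^T <= kermx D^T)%MS.
  move=> CD; apply/rV_subP => u; rewrite !sub_kermx => /eqP uC.
  apply/eqP/trmx_inj; rewrite trmx_mul trmxK trmx0; apply: CD.
  by apply/trmx_inj; rewrite trmx_mul trmxK uC trmx0.
have : \rank (kermx A^T) = \rank (kermx B^T).
  by apply/eqP; rewrite eqn_leq !mxrankS //; apply: ker_le => f /eqAB.
rewrite !mxrank_ker !mxrank_tr => eqr.
by rewrite -(subKn (rank_leq_col A)) eqr subKn // rank_leq_col.
Qed.

(** * Counting and enumerating monomials *)

(** The new variable, of index 0, takes up the missing degree. *)
Definition homogenize (n d : nat) (m : 'X_{1..n < d.+1}) : 'X_{1..n.+1} :=
  [multinom (if unlift ord0 i is Some j then m j else d - mdeg m)%N | i < n.+1].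

Lemma homogenize_inj (n d : nat) : injective (@homogenize n d).
Proof.
move=> m1 m2 /mnmP eqm; apply/val_inj/mnmP => j.
by have := eqm (lift ord0 j); rewrite !mnmE !liftK.
Qed.

Lemma mdeg_homogenize (n d : nat) (m : 'X_{1..n < d.+1}) :
  mdeg (homogenize m) = d.
Proof.
rewrite mdegE big_ord_recl mnmE unlift_none.
under eq_bigr => j _ do rewrite mnmE liftK.
by rewrite -mdegE subnK // -ltnS bmdeg.
Qed.

Lemma homogenize_onto (n d : nat) (m : 'X_{1..n.+1}) :
  mdeg m = d -> exists m' : 'X_{1..n < d.+1}, m = homogenize m'.
Proof.
move=> degm; pose m0 : 'X_{1..n} := [multinom m (lift ord0 j) | j < n].
have degm0 : (m ord0 + mdeg m0 = d)%N.
  rewrite -degm [mdeg m]mdegE big_ord_recl mdegE; congr (_ + _)%N.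
  by apply: eq_bigr => j _; rewrite mnmE.
have m0d : (mdeg m0 < d.+1)%N by rewrite ltnS -degm0 leq_addl.
exists (BMultinom m0d); apply/mnmP => i; rewrite mnmE /=.
by case: unliftP => [j|] ->; rewrite ?mnmE // -degm0 addnK.
Qed.

(** Homogenization turns the monomials of degree at most d in n variables into
    those of degree exactly d in n + 1 variables, which are the multisets of d
    variables. *)
Lemma card_bmultinom (n d : nat) : #|{: 'X_{1..n < d.+1}}| = 'C(d + n, d).
Proof.
rewrite -size_basis cardE -(size_map (@homogenize n d)).
apply/perm_size/uniq_perm; last move=> m.
- by rewrite map_inj_uniq ?enum_uniq //; apply: homogenize_inj.
- exact: uniq_basis.
rewrite -basis_cover; apply/mapP/eqP => [[m' _ ->]|].
  exact: mdeg_homogenize.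
by case/homogenize_onto => m' ->; exists m'; rewrite ?mem_enum.
Qed.

Lemma card_quad_monomials (n : nat) : #|{: 'X_{1..n < 3}}| = quad_dim n.
Proof. by rewrite card_bmultinom bin2 /quad_dim mulnC -divn2 addnC addn1 addn2. Qed.

Lemma mdeg_succ (n d : nat) (m : 'X_{1..n}) :
  mdeg m = d.+1 -> exists l (m' : 'X_{1..n}), mdeg m' = d /\ m = (U_(l) + m')%MM.
Proof.
move=> degm; case: (pickP (fun l => m l != 0%N)) => [l ml|m0]; last first.
  suff: mdeg m = 0%N by rewrite degm.
  by rewrite mdegE big1 // => l _; apply/eqP; have := m0 l; case: eqP.
have U_le : (U_(l) <= m)%MM.
  by apply/mnm_lepP => l'; rewrite mnm1E; case: eqP => // <-; rewrite lt0n.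
exists l, (m - U_(l))%MM; have mE : m = (U_(l) + (m - U_(l)))%MM.
  by rewrite addmC submK.
by split=> //; move: degm; rewrite {1}mE mdegD mdeg1 add1n => -[].
Qed.

Definition monom_of (n b : nat) (c : 'I_#|{: 'X_{1..n < b}}|) : 'X_{1..n} :=
  bmnm (enum_val c).

Lemma monom_of_inj (n b : nat) : injective (@monom_of n b).
Proof. by move=> c d /val_inj /enum_val_inj. Qed.

Lemma monom_of_onto (n b : nat) (m : 'X_{1..n}) :
  (mdeg m < b)%N -> exists c : 'I_#|{: 'X_{1..n < b}}|, m = monom_of c.
Proof.
by move=> mb; exists (enum_rank (BMultinom mb)); rewrite /monom_of enum_rankK.
Qed.

(** * General position as a rank condition *)

(** The rows are the images of the points under the Veronese map of degree
    b - 1, in the affine chart where the constant monomial is 1. *)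
Definition veronese (R : realType) (n k : nat) (b : nat) (x : 'I_k -> 'cV[R]_n) :
    'M[R]_(k, #|{: 'X_{1..n < b}}|) :=
  \matrix_(i, c) evalpt 'X_[monom_of c] (x i).

Definition mpoly_of_col (R : realType) (n b : nat)
    (v : 'cV[R]_#|{: 'X_{1..n < b}}|) : {mpoly R[n]} :=
  \sum_c v c 0 *: 'X_[monom_of c].

Definition col_of_mpoly (R : realType) (n b : nat) (q : {mpoly R[n]}) :
    'cV[R]_#|{: 'X_{1..n < b}}| :=
  \col_c q@_(monom_of c).

Lemma msize_mpoly_of_col (R : realType) (n b : nat)
    (v : 'cV[R]_#|{: 'X_{1..n < b}}|) : (msize (mpoly_of_col v) <= b)%N.
Proof.
apply: (leq_trans (msize_sum _ _ _)); apply/bigmax_leqP => c _.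
by rewrite (leq_trans (msizeZ_le _ _)) // msizeX bmdeg.
Qed.

Lemma col_of_mpolyK (R : realType) (n b : nat) (q : {mpoly R[n]}) :
  (msize q <= b)%N -> mpoly_of_col (col_of_mpoly b q) = q.
Proof.
move=> qb; rewrite [RHS](mpolywE qb) /mpoly_of_col.
rewrite [RHS](reindex (fun c : 'I_#|{: 'X_{1..n < b}}| => enum_val c)) /=.
  by apply: eq_bigr => c _; rewrite mxE.
exact: (onW_bij _ (@enum_val_bij _)).
Qed.

Lemma mpoly_of_colK (R : realType) (n b : nat)
    (v : 'cV[R]_#|{: 'X_{1..n < b}}|) :
  col_of_mpoly b (mpoly_of_col v) = v.
Proof.
apply/colP => c; rewrite mxE raddf_sum /= (bigD1 c) //= big1 => [|d dc].
  by rewrite mcoeffZ mcoeffX eqxx mulr1 addr0.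
by rewrite mcoeffZ mcoeffX (inj_eq (@monom_of_inj _ _)) (negPf dc) mulr0.
Qed.

Lemma evalpt_mpoly_of_col (R : realType) (n k b : nat)
    (x : 'I_k -> 'cV[R]_n) (v : 'cV[R]_#|{: 'X_{1..n < b}}|) i :
  evalpt (mpoly_of_col v) (x i) = (veronese b x *m v) i 0.
Proof.
rewrite mxE /evalpt /mpoly_of_col raddf_sum /=; apply: eq_bigr => c _.
by rewrite mevalZ mxE mulrC.
Qed.

(** Each half of general position is full rank on one side: interpolation
    means that the rows of W are independent, and the absence of a quadric
    through the points that the columns are, since a relation among the
    columns is the coefficient vector of such a quadric. *)
Lemma general_position_rank (R : realType) (n k : nat) (x : 'I_k -> 'cV[R]_n) :
  quadric_general_position x <-> \rank (veronese 3 x) = minn k (quad_dim n).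
Proof.
rewrite /quadric_general_position -card_quad_monomials.
set W := veronese 3 x; set N := #|_|.
split=> [[interp noquad]|rankW].
  case: (leqP k N) => [kN|/ltnW Nk]; apply/eqP.
    apply: inj_row_free => u uW; apply/rowP => i.
    (* Pairing the relation u with the interpolant of the indicator of i
       extracts the coefficient of u at i. *)
    have [q q3 qx] := interp kN (fun j => (j == i)%:R).
    have : (u *m W *m col_of_mpoly 3 q) 0 0 = 0 by rewrite uW mul0mx mxE.
    rewrite -mulmxA mxE (bigD1 i) //= big1 => [|j ji].
      by rewrite -evalpt_mpoly_of_col col_of_mpolyK // qx eqxx mulr1 addr0 mxE.
    by rewrite -evalpt_mpoly_of_col col_of_mpolyK // qx (negPf ji) mulr0.
  rewrite -mxrank_tr; apply: inj_row_free => u uW.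
  have Wu : W *m u^T = 0 by apply/trmx_inj; rewrite trmx_mul trmxK uW trmx0.
  apply/trmx_inj; rewrite -[u^T]mpoly_of_colK (noquad Nk _ (msize_mpoly_of_col _)).
    by apply/matrixP => c j; rewrite !mxE mcoeff0.
  by move=> i; rewrite evalpt_mpoly_of_col -/W Wu mxE.
split=> [kN v|Nk q q3 qx].
  have /row_freeP[B WB] : row_free W by rewrite /row_free rankW (minn_idPl kN).
  exists (mpoly_of_col (B *m \col_i v i)); first exact: msize_mpoly_of_col.
  by move=> i; rewrite evalpt_mpoly_of_col -/W mulmxA WB mul1mx mxE.
have Wfree : row_free W^T by rewrite /row_free mxrank_tr rankW (minn_idPr Nk).
have q0 : W *m col_of_mpoly 3 q = 0.
  by apply/colP => i; rewrite -evalpt_mpoly_of_col col_of_mpolyK // qx mxE.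
have {}q0 : (col_of_mpoly 3 q)^T = 0.
  by apply: (row_free_inj Wfree); rewrite -trmx_mul q0 mul0mx trmx0.
rewrite -(col_of_mpolyK q3) /mpoly_of_col big1 // => c _.
by rewrite -[col_of_mpoly 3 q]trmxK q0 !mxE scale0r.
Qed.

(** * General position is generic *)

(** The monomial m in the coordinates of the i-th point. *)
Definition place_monom (n k : nat) (i : 'I_k) (m : 'X_{1..n}) : 'X_{1..k * n} :=
  (\sum_l U_(mxvec_index i l) *+ m l)%MM.

Lemma mxvec_index_eq (n k : nat) (i i' : 'I_k) (l l' : 'I_n) :
  (mxvec_index i l == mxvec_index i' l') = (i == i') && (l == l').
Proof.
apply/eqP/andP => [|[/eqP-> /eqP->]] //.
have /bij_inj inj := onT_bij (curry_mxvec_bij k n).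
by move=> /(inj (i, l) (i', l')) [-> ->].
Qed.

Lemma place_monomE (n k : nat) (i i' : 'I_k) (m : 'X_{1..n}) (l : 'I_n) :
  place_monom i m (mxvec_index i' l) = if i == i' then m l else 0%N.
Proof.
rewrite mnm_sumE (bigD1 l) //= big1 => [|l' l'l].
  by rewrite mulmnE mnm1E mxvec_index_eq eqxx andbT addn0; case: eqP; rewrite ?mul1n.
by rewrite mulmnE mnm1E mxvec_index_eq (negPf l'l) andbF.
Qed.

Lemma meval_place_monom (R : realType) (n k : nat) (x : 'I_k -> 'cV[R]_n)
    (i : 'I_k) (m : 'X_{1..n}) :
  ('X_[place_monom i m]).@[mxvec (\matrix_(i < k, l < n) x i l 0) 0] =
  evalpt 'X_[m] (x i).
Proof.
rewrite /place_monom -mprodXnE rmorph_prod /= /evalpt mevalX.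
by apply: eq_bigr => l _; rewrite rmorphXn /= mevalXU mxvecE mxE.
Qed.

(** The term of the Leibniz expansion attached to a permutation s is, up to
    sign, the monomial M s.  Its restriction to the variables of the point p i
    is m (s i), so that M s determines s and no two terms can cancel. *)
Lemma det_placed_monoms_neq0 (R : realType) (n k r : nat)
    (p : 'I_r -> 'I_k) (m : 'I_r -> 'X_{1..n}) :
  injective p -> injective m ->
  \det (\matrix_(i, c) ('X_[place_monom (p i) (m c)] : {mpoly R[k * n]})) != 0.
Proof.
move=> p_inj m_inj; pose M (s : 'S_r) := (\sum_i place_monom (p i) (m (s i)))%MM.
have ME s i l : M s (mxvec_index (p i) l) = m (s i) l.
  rewrite mnm_sumE (bigD1 i) //= place_monomE eqxx big1 ?addn0 // => j ji.
  by rewrite place_monomE (inj_eq p_inj) (negPf ji).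
have M_inj : injective M.
  move=> s t eqM; apply/permP => i; apply/m_inj/mnmP => l.
  by rewrite -!ME eqM.
set A := \matrix_(i, c) _.
have prodA (s : 'S_r) : \prod_i A i (s i) = 'X_[M s].
  by rewrite -mprodXE; apply: eq_bigr => i _; rewrite mxE.
apply/eqP => /(congr1 (mcoeff (M (1%g : 'S_r)))) /eqP.
rewrite mcoeff0 raddf_sum /= (bigD1 (1%g : 'S_r)) //= [X in _ + X]big1 => [|s s1].
  by rewrite odd_perm1 mul1r prodA mcoeffX eqxx addr0 oner_eq0.
rewrite prodA mulr_sign; case: odd_perm;
  by rewrite ?mcoeffN mcoeffX (inj_eq M_inj) (negPf s1) ?oppr0.
Qed.

Lemma generic_quadric_general_position (R : realType) (n k : nat) :
  generically (@quadric_general_position R n k).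
Proof.
set N := #|{: 'X_{1..n < 3}}|; set r := minn k N.
pose row_of := widen_ord (geq_minl k N) : 'I_r -> 'I_k.
pose col_of := widen_ord (geq_minr k N) : 'I_r -> 'I_N.
have row_inj : injective row_of by move=> i j [/ord_inj].
have col_inj : injective col_of by move=> i j [/ord_inj].
exists (\det (\matrix_(i, c) 'X_[place_monom (row_of i) (monom_of (col_of c))])).
  by apply: det_placed_monoms_neq0 => //; apply: inj_comp col_inj; apply: monom_of_inj.
move=> x; rewrite -det_map_mx => minor_neq0; apply/general_position_rank.
rewrite -card_quad_monomials -/N -/r; apply/eqP; rewrite eqn_leq; apply/andP; split.
  by rewrite leq_min rank_leq_row rank_leq_col.
pose S := colsub col_of (rowsub row_of (veronese 3 x)).
have <- : \rank S = r.
  apply: mxrank_unit; rewrite unitmxE unitfE.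
  apply: contraNneq minor_neq0 => detS; rewrite -[X in _ == X]detS; apply/eqP; congr (\det _).
  by apply/matrixP => i c; rewrite !mxE /= meval_place_monom.
rewrite /S -[rowsub _ _]mulmx1 -mulmx_colsub (leq_trans (mxrankM_maxl _ _)) //.
by rewrite rowsubE mxrankM_maxr.
Qed.

(** * The kernel of the system *)

Definition moment (R : realType) (n k : nat) (x : 'I_k -> 'cV[R]_n)
    (f : 'cV[R]_k) (q : {mpoly R[n]}) : R :=
  \sum_i f i 0 * evalpt q (x i).

Lemma veronese_kernel (R : realType) (n k : nat) (x : 'I_k -> 'cV[R]_n)
    (f : 'cV[R]_k) :
  (veronese 3 x)^T *m f = 0 <->
  [/\ moment x f 1 = 0,
      forall l, moment x f 'X_l = 0 &
      forall l m, moment x f ('X_l * 'X_m) = 0].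
Proof.
have WE c : ((veronese 3 x)^T *m f) c 0 = moment x f 'X_[monom_of c].
  by rewrite mxE; apply: eq_bigr => i _; rewrite !mxE mulrC.
split=> [Wf|[mom0 mom1 mom2]].
  have mom_eq0 (m : 'X_{1..n}) : (mdeg m < 3)%N -> moment x f 'X_[m] = 0.
    by case/monom_of_onto => c ->; rewrite -WE Wf mxE.
  split=> [|l|l m]; first by rewrite -mpolyX0 mom_eq0 // mdeg0.
    by rewrite mom_eq0 // mdeg1.
  by rewrite -mpolyXD mom_eq0 // mdegD !mdeg1.
apply/colP => c; rewrite WE mxE.
have : (mdeg (monom_of c) < 3)%N by apply: bmdeg.
case degm : (mdeg (monom_of c)) => [|d].
  by move/eqP: degm; rewrite mdeg_eq0 => /eqP->; rewrite mpolyX0.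
have [l [m [degm' ->]]] := mdeg_succ degm.
case: d degm' {degm} => [|[|//]] degm' _.
  by move/eqP: degm'; rewrite mdeg_eq0 => /eqP->; rewrite addm0.
have [l' [m' [/eqP]]] := mdeg_succ degm'.
by rewrite mdeg_eq0 => /eqP-> ->; rewrite addm0 mpolyXD.
Qed.

Lemma outer_sq_subE (R : realType) (n k : nat) (x : 'I_k -> 'cV[R]_n) j i l m :
  outer_sq (@eta_sub R n) x j i l m =
  (x j l 0 - x i l 0) * (x j m 0 - x i m 0).
Proof. by rewrite mxE big_ord1 !mxE. Qed.

Lemma sum_outer_sqE (R : realType) (n k : nat) (x : 'I_k -> 'cV[R]_n)
    (f : 'cV[R]_k) j l m :
  (\sum_(i < k) f i 0 *: outer_sq (@eta_sub R n) x j i) l m =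
  moment x f 1 * x j l 0 * x j m 0 - x j l 0 * moment x f 'X_m
  - moment x f 'X_l * x j m 0 + moment x f ('X_l * 'X_m).
Proof.
rewrite summxE /moment mulr_sumr !mulr_suml -!sumrB -big_split /=.
apply: eq_bigr => i _; rewrite mxE outer_sq_subE /evalpt.
by rewrite meval1 mevalM !mevalXU; ring.
Qed.

Lemma outer_sq_eq0 (F : fieldType) (n : nat) (u : 'cV[F]_n) :
  (forall l m, u l 0 * u m 0 = 0) -> u = 0.
Proof.
move=> u0; apply/colP => l; rewrite mxE; apply/eqP.
by have /eqP := u0 l l; rewrite mulf_eq0 orbb.
Qed.

(** At an index l with u l <> 0 the diagonal entry fixes v l up to sign, and
    the other entries of row l propagate that sign to all coordinates. *)
Lemma outer_sq_eq (F : fieldType) (n : nat) (u v : 'cV[F]_n) :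
  (forall l m, u l 0 * u m 0 = v l 0 * v m 0) -> u = v \/ u = - v.
Proof.
move=> uv; case: (pickP (fun l => u l 0 != 0)) => [l ul|u0]; last first.
  have {}u0 : u = 0 by apply/colP => l; rewrite mxE; apply/eqP; have := u0 l; case: eqP.
  left; rewrite u0; apply/esym/outer_sq_eq0 => l m.
  by rewrite -uv u0 mxE mul0r.
have /eqP := uv l l; rewrite -!expr2 eqf_sqr => /orP[]/eqP uvl; [left|right].
  by apply/colP => m; apply: (mulfI ul); rewrite uv uvl.
apply/colP => m; apply: (mulfI ul); rewrite uv mxE uvl.
by rewrite mulrNN.
Qed.

(** The diagonal entry at l0 is 2 (d l0) (s l0), which kills d l0; row l0 then
    kills the remaining coordinates. *)
Lemma sym_outer_eq0 (F : numFieldType) (n : nat) (d s : 'cV[F]_n) (l0 : 'I_n) :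
  s l0 0 != 0 -> (forall l m, d l 0 * s m 0 + s l 0 * d m 0 = 0) -> d = 0.
Proof.
move=> s0 ds.
have d0 : d l0 0 = 0.
  have /eqP := ds l0 l0; rewrite [s l0 0 * _]mulrC -mulr2n mulrn_eq0 mulf_eq0.
  by rewrite (negPf s0) orbF => /eqP.
apply/colP => m; rewrite mxE; have /eqP := ds l0 m.
by rewrite d0 mul0r add0r mulf_eq0 (negPf s0) => /eqP.
Qed.

(** Both hypotheses are used against degenerate moments: a nonzero S1 makes all
    the points equal, and a nonzero S0 leaves only two points, whose weights
    must vanish. *)
Lemma outer_sq_kernel (R : realType) (n k : nat) (x : 'I_k -> 'cV[R]_n)
    (f : 'cV[R]_k) : (1 < k)%N -> injective x ->
  (forall j, \sum_(i < k) f i 0 *: outer_sq (@eta_sub R n) x j i = 0) <->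
  (veronese 3 x)^T *m f = 0.
Proof.
move=> k1 x_inj; split=> [Yf|/veronese_kernel[S0 S1 S2] j]; last first.
  by apply/matrixP => l m; rewrite sum_outer_sqE S0 !S1 S2 !mxE; ring.
have YfE j l m : moment x f 1 * x j l 0 * x j m 0 - x j l 0 * moment x f 'X_m
    - moment x f 'X_l * x j m 0 + moment x f ('X_l * 'X_m) = 0.
  by rewrite -sum_outer_sqE Yf mxE.
have other (j : 'I_k) : exists j', j' != j.
  case: (pickP (fun j' => j' != j)) => [j' j'j|none]; first by exists j'.
  have := card_ord k; rewrite (@eq_card1 _ j) => [kE|j']; first by rewrite -kE in k1.
  by have := none j'; rewrite !inE; case: eqP.
have [S0|S0] := eqVneq (moment x f 1) 0.
  have S1 : forall l, moment x f 'X_l = 0.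
    move=> l; apply/eqP/negPn/negP => S1l.
    have [j' /eqP[]] := other (Ordinal k1); apply/x_inj/eqP.
    rewrite -subr_eq0; apply/eqP.
    apply: (@sym_outer_eq0 _ _ _ (\col_l moment x f 'X_l) l); first by rewrite mxE.
    move=> l1 m1; rewrite !mxE.
    have := congr2 (fun a b => a - b) (YfE (Ordinal k1) l1 m1) (YfE j' l1 m1).
    by rewrite S0 subr0 => <-; ring.
  apply/veronese_kernel; split=> // l m.
  by have := YfE (Ordinal k1) l m; rewrite S0 !S1 => <-; ring.
suff -> : f = 0 by rewrite mulmx0.
(* Completing the square in S0 x_j x_j^T - x_j S1^T - S1 x_j^T + S2 = 0:
   u j (u j)^T = S1 S1^T - S0 S2 does not depend on j. *)
pose c := \col_l moment x f 'X_l.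
pose u j := moment x f 1 *: x j - c.
have u_inj : injective u by move=> i j /addIr /(scalerI S0) /x_inj.
have u_opp i j : i != j -> u i = - u j.
  move=> ij; case: (@outer_sq_eq _ _ (u i) (u j)) => // [l m|/u_inj eqij].
    rewrite !mxE; have := congr2 (fun a b => moment x f 1 * (a - b)) (YfE i l m) (YfE j l m).
    by rewrite subrr mulr0 => /eqP; rewrite -subr_eq0 => /eqP E; apply/eqP; rewrite -subr_eq0 -E; apply/eqP; ring.
  by rewrite eqij eqxx in ij.
apply/colP => j; rewrite mxE; have [j0 j0j] := other j.
apply/eqP/negPn/negP => fj.
(* Every point other than x j0 has the opposite u, hence equals x j: the
   equation at j0 is f j (x j0 - x j) (x j0 - x j)^T = 0. *)
have : x j0 - x j = 0.
  apply: outer_sq_eq0 => l m.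
  have /matrixP/(_ l m) := Yf j0; rewrite summxE (bigD1 j) //= big1 => [|i ij].
    rewrite addr0 mxE outer_sq_subE !mxE => /eqP.
    by rewrite mulf_eq0 (negPf fj) => /eqP.
  suff -> : i = j0 by rewrite mxE outer_sq_subE subrr mul0r mulr0.
  by apply: u_inj; rewrite (u_opp i j ij) (u_opp j0 j j0j).
by move/eqP; rewrite subr_eq0 => /eqP/x_inj/eqP; rewrite (negPf j0j).
Qed.

Lemma Ymatrix_kernel (R : realType) (n k : nat)
    (eta : 'cV[R]_n -> 'cV[R]_n -> 'cV[R]_n) (x : 'I_k -> 'cV[R]_n)
    (f : 'cV[R]_k) :
  (\mxcol_(l < n) \mxcol_(m < n) Bblock eta x l m) *m f = 0 <->
  forall j, \sum_(i < k) f i 0 *: outer_sq eta x j i = 0.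
Proof.
have BE l m j : (Bblock eta x l m *m f) j 0 =
    (\sum_(i < k) f i 0 *: outer_sq eta x j i) l m.
  rewrite summxE mxE; apply: eq_bigr => i _.
  by rewrite [Bblock _ _ _ _ _ _]mxE [RHS]mxE mulrC.
rewrite mxcol_mul; split=> [Bf j|Yf].
  apply/matrixP => l m; rewrite -BE.
  move: Bf; rewrite -(@mxcol0 _ _ _ 1) => /eq_mxcolP/(_ l).
  rewrite mxcol_mul -(@mxcol0 _ _ _ 1) => /eq_mxcolP/(_ m) ->.
  by rewrite !mxE.
rewrite -(@mxcol0 _ _ _ 1); apply/eq_mxcolP => l.
rewrite mxcol_mul -(@mxcol0 _ _ _ 1); apply/eq_mxcolP => m.
by apply/colP => j; rewrite BE Yf !mxE.
Qed.

Lemma Ymatrix_rank (R : realType) (n k : nat) (x : 'I_k -> 'cV[R]_n) :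
  (1 < k)%N -> injective x ->
  \rank (Ymatrix (@eta_sub R n) x) = \rank (veronese 3 x).
Proof.
move=> k1 x_inj; rewrite mxrank_castmx_row -[RHS]mxrank_tr.
apply: eq_colker_rank => f; rewrite Ymatrix_kernel.
exact: outer_sq_kernel.
Qed.

Theorem proposition4 (R : realType) (n k : nat) (hk : (1 < k)%N) :
  (forall x : 'I_k -> 'cV[R]_n, injective x ->
     (quadric_general_position x ->
        \rank (Ymatrix (@eta_sub R n) x) = minn k (((n + 1) * (n + 2)) %/ 2)) /\
     ((((n + 1) * (n + 2)) %/ 2 < k)%N ->
        forall f0 : 'cV[R]_k,
          ~ (exists! f : 'cV[R]_k, forall j : 'I_k,
               \sum_(i < k) f i 0 *: outer_sq (@eta_sub R n) x j i =
               \sum_(i < k) f0 i 0 *: outer_sq (@eta_sub R n) x j i))) /\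
  generically (@quadric_general_position R n k).
Proof.
split; last exact: generic_quadric_general_position.
move=> x x_inj; split=> [|k_gt f0 [f1 [_ f1_uniq]]].
  by move/general_position_rank <-; apply: Ymatrix_rank.
have : kermx (veronese 3 x) != 0.
  rewrite kermx_eq0 /row_free neq_ltn (leq_ltn_trans (rank_leq_col _)) //.
  by rewrite card_quad_monomials.
case/rowV0Pn => u; rewrite sub_kermx => /eqP uW /eqP[].
have /(outer_sq_kernel _ hk x_inj) Yu : (veronese 3 x)^T *m u^T = 0.
  by rewrite -trmx_mul uW trmx0.
have f1_f0 : f1 = f0 by apply: f1_uniq.
have f1_f0u : f1 = f0 + u^T.
  apply: f1_uniq => j; rewrite -[RHS]addr0 -[X in _ = _ + X](Yu j) -big_split /=.
  by apply: eq_bigr => i _; rewrite mxE scalerDl.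
apply/trmx_inj/(addrI f0); rewrite -f1_f0u trmx0 addr0.
exact: f1_f0.
Qed.
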